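(* Let $d\in\mathbb N$ and let $\gamma_\nu:\mathcal C_2\to\mathbb R$ be a generalized Gini's gamma. Then $\mathcal P_d^{\mathrm B}\subseteq\mathcal R_d(\gamma_\nu)\subseteq\mathcal P_d$.
   Context: For $d\in\mathbb N$, a $d$-copula is a distribution function $C:[0,1]^d\to[0,1]$ with standard uniform univariate margins; $\mathcal C_d$ is the set of all $d$-copulas. $(U,V)\sim C$ means that $(U,V)$ is a random vector with distribution function $C$. $M(u,v)=\min(u,v)$ and $\Pi(u,v)=uv$. Let $\mathcal D_4=\{e,\tau,\sigma_1,\sigma_2,\tau\sigma_1,\tau\sigma_2,\sigma_1\sigma_2,\tau\sigma_1\sigma_2\}$ be the group of symmetries of $(0,1)^2$ with $e(u,v)=(u,v)$, $\sigma_1(u,v)=(1-u,v)$, $\sigma_2(u,v)=(u,1-v)$, $\tau(u,v)=(v,u)$. $\mathcal M$ is the set of admissible $D_4$-invariant measures: Borel measures $\mu$ on $(0,1)^2$ such that $\mu(\xi(A))=\mu(A)$ for all $\xi\in\mathcal D_4$ and Borel $A\subseteq(0,1)^2$, and $0<\int_{(0,1)^2}(M-\Pi)\,\mathrm d\mu<\infty$. A generalized Gini's gamma is a map $\kappa:\mathcal C_2\to\mathbb R$ (a measure of concordance) of the form $$\kappa(C)=\frac{\int_{(0,1)^2}(C-\Pi)\,\mathrm d\mu}{\int_{(0,1)^2}(M-\Pi)\,\mathrm d\mu},\quad C\in\mathcal C_2,$$ for some $\mu\in\mathcal M$ whose mass is concentrated on $\{(u,v)\in(0,1)^2: u=v\text{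 or }u+v=1\}$. (The subscript $\nu$ in $\gamma_\nu$ is only a label for the particular generalized Gini's gamma.) Here a measure of concordance is a map $\kappa:\mathcal C_2\to\mathbb R$ such that, writing $\kappa(U,V)$ for $\kappa(C)$ when $(U,V)\sim C$: (1) $\kappa(M)=1$; (2) $\kappa(V,U)=\kappa(U,V)$; (3) $\kappa(U,1-V)=-\kappa(U,V)$; (4) $\kappa(C)\le\kappa(C')$ if $C\le C'$ pointwise; (5) $\kappa(C_n)\to\kappa(C)$ if $C_n\to C$ pointwise. For a measure of concordance $\kappa$, the compatible set is $\mathcal R_d(\kappa)=\{(\kappa(C_{i,j}))_{i,j=1,\dots,d}: C\in\mathcal C_d\}$, where $C_{i,j}$ for $i\ne j$ is the $(i,j)$-marginal copula of $C$ (the distribution function of $(U_i,U_j)$ for $(U_1,\dots,U_d)\sim C$), and $C_{i,i}=M$, so that diagonal entries equal $1$. $\mathcal P_d$ (the elliptope) is the set of all $d\times d$ correlation matrices, i.e. symmetric positive semi-definite real $d\times d$ matrices with all diagonal entries equal to $1$. $\mathcal P_d^{\mathrm B}$ (the cut polytope) is the set of all Pearson correlation matrices of $d$-dimensional random vectors whose components each have the symmetric Bernoulli distribution $\mathbb P(X_i=0)=\mathbb P(X_i=1)=\tfrac12$. *)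

(* Defs.v *)
From HB Require Import structures.
From mathcomp Require Import all_boot all_order all_algebra.
From mathcomp Require Import all_classical all_reals all_analysis.

Set Implicit Arguments.
Unset Strict Implicit.
Unset Printing Implicit Defensive.

Import Order.TTheory GRing.Theory Num.Theory.
Import numFieldNormedType.Exports.

Local Open Scope classical_set_scope.
Local Open Scope ring_scope.

Definition cube (R : realType) (d : nat) : set (d.-tuple R) :=
  [set u | forall i, 0 <= tnth u i <= 1].
Arguments cube {R} d.

(* [has_df U C] is U ~ C.  A function on [0,1]^d is represented by a function
   on d.-tuple R; its values outside the cube are never used. *)
Definition has_df (R : realType) (dsp : measure_display)
    (Om : measurableType dsp) (P : probability Om R) (d : nat)
    (U : d.-tuple {RV P >-> R}) (C : d.-tuple R -> R) : Prop :=
  forall u, cube d u ->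
    P [set w | forall i, tnth U i w <= tnth u i] = (C u)%:E.

Definition std_uniform (R : realType) (dsp : measure_display)
    (Om : measurableType dsp) (P : probability Om R) (X : {RV P >-> R}) : Prop :=
  forall r : R, 0 <= r <= 1 -> cdf X r = r%:E.

Definition is_copula (R : realType) (d : nat) (C : d.-tuple R -> R) : Prop :=
  exists (dsp : measure_display) (Om : measurableType dsp)
         (P : probability Om R) (U : d.-tuple {RV P >-> R}),
    (forall i, std_uniform (tnth U i)) /\ has_df U C.

Definition copM (R : realType) (u : 2.-tuple R) : R :=
  Num.min (tnth u ord0) (tnth u ord_max).

Definition copPi (R : realType) (u : 2.-tuple R) : R :=
  tnth u ord0 * tnth u ord_max.

Arguments copM {R} u.
Arguments copPi {R} u.

(* A map on the set of 2-copulas is represented by a function on all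
   functions 2.-tuple R -> R, constrained on copulas only. *)
Record measure_of_concordance (R : realType)
    (kappa : (2.-tuple R -> R) -> R) : Prop := MeasureOfConcordance {
  concordance_norm : kappa copM = 1 ;
  concordance_sym : forall (dsp : measure_display) (Om : measurableType dsp)
    (P : probability Om R) (U V : {RV P >-> R}) (C C' : 2.-tuple R -> R),
    is_copula C -> is_copula C' ->
    has_df [tuple U; V] C -> has_df [tuple V; U] C' ->
    kappa C' = kappa C ;
  concordance_refl : forall (dsp : measure_display) (Om : measurableType dsp)
    (P : probability Om R) (U V V' : {RV P >-> R}) (C C' : 2.-tuple R -> R),
    is_copula C -> is_copula C' ->
    (forall w, V' w = 1 - V w) ->
    has_df [tuple U; V] C -> has_df [tuple U; V'] C' ->
    kappa C' = - kappa C ;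
  concordance_mono : forall C C' : 2.-tuple R -> R,
    is_copula C -> is_copula C' ->
    (forall u, cube 2 u -> C u <= C' u) ->
    kappa C <= kappa C' ;
  concordance_cont : forall (Cn : nat -> 2.-tuple R -> R) (C : 2.-tuple R -> R),
    (forall n, is_copula (Cn n)) -> is_copula C ->
    (forall u, cube 2 u -> Cn n u @[n --> \oo] --> C u) ->
    kappa (Cn n) @[n --> \oo] --> kappa C
}.

Section symmetries.
Context {R : realType}.

Definition tau (x : R * R) : R * R := (x.2, x.1).
Definition sigma1 (x : R * R) : R * R := (1 - x.1, x.2).
Definition sigma2 (x : R * R) : R * R := (x.1, 1 - x.2).

Definition D4 : set (R * R -> R * R) :=
  [set id; tau; sigma1; sigma2; tau \o sigma1; tau \o sigma2;
       sigma1 \o sigma2; tau \o sigma1 \o sigma2].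

Definition open_square : set (R * R) := `]0, 1[ `*` `]0, 1[.

End symmetries.

(* A Borel measure on the open square is the restriction to it of a measure on
   R * R: only subsets of [open_square] and integrals over it are used. *)
Definition admissible (R : realType)
    (mu : {measure set (R * R) -> \bar R}) : Prop :=
  (forall (xi : R * R -> R * R) (A : set (R * R)),
     D4 xi -> measurable A -> A `<=` open_square -> mu (xi @` A) = mu A) /\
  (0 < \int[mu]_(x in open_square)
         (copM [tuple x.1; x.2] - copPi [tuple x.1; x.2])%:E < +oo)%E.

Definition generalized_gini (R : realType)
    (kappa : (2.-tuple R -> R) -> R) : Prop :=
  measure_of_concordance kappa /\
  exists mu : {measure set (R * R) -> \bar R},
    [/\ admissible mu,
        mu (open_square `\` [set x | x.1 = x.2 \/ x.1 + x.2 = 1]) = 0%E &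
        forall C, is_copula C ->
          kappa C =
            (\int[mu]_(x in open_square)
               (C [tuple x.1; x.2] - copPi [tuple x.1; x.2])) /
            (\int[mu]_(x in open_square)
               (copM [tuple x.1; x.2] - copPi [tuple x.1; x.2]))].

Definition margin2 (R : realType) (d : nat) (C : d.-tuple R -> R)
    (i j : 'I_d) (u : 2.-tuple R) : R :=
  C [tuple if k == i then tnth u ord0 else if k == j then tnth u ord_max else 1
    | k < d].

Lemma margin2P (R : realType) (dsp : measure_display)
    (Om : measurableType dsp) (P : probability Om R) (d : nat)
    (U : d.-tuple {RV P >-> R}) (C : d.-tuple R -> R) (i j : 'I_d) :
  (forall k, std_uniform (tnth U k)) -> has_df U C -> i != j ->
  has_df [tuple tnth U i; tnth U j] (margin2 C i j).
Proof.
move=> unifU UC ij u u01; rewrite /margin2 -UC; last first.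
  move=> k; rewrite tnth_mktuple; case: ifP => _; first exact: u01.
  by case: ifP => _; [exact: u01 | rewrite ler01 lexx].
pose G (k : 'I_d) r := [set w | tnth U k w <= r].
have mG k r : measurable (G k r).
  rewrite (_ : G k r = tnth U k @^-1` `]-oo, r]); first exact: measurable_funPTI.
  by apply/seteqP; split => w; rewrite /G /= in_itv.
have null k : P.-negligible (~` G k 1).
  apply/(negligibleP _ (measurableC (mG k 1))).
  rewrite [LHS](probability_setC P (mG k 1)); have := unifU k 1.
  rewrite ler01 lexx => /(_ isT); rewrite /cdf /distribution /pushforward.
  rewrite (_ : _ @^-1` _ = G k 1); first by move=> ->; rewrite subee.
  by apply/seteqP; split => w; rewrite /G /= in_itv.
set A := (X in P X = _); set B := (X in _ = P X).
have AE : A = G i (tnth u ord0) `&` G j (tnth u ord_max).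
  apply/seteqP; split => w; rewrite /A /G /=.
    by move=> Aw; split; [exact: (Aw ord0) | exact: (Aw ord_max)].
  move=> [wi wj] k; case: (unliftP ord0 k) => [l ->|-> //].
  by rewrite (ord1 l) (_ : lift _ _ = ord_max)//; apply: val_inj.
have BE : B = \bigcap_(k in [set: 'I_d]) G k (tnth [tuple
    if k == i then tnth u ord0 else if k == j then tnth u ord_max else 1
    | k < d] k).
  by apply/seteqP; split => w /= Bw k; [move=> _; exact: Bw | exact: Bw].
have mA : measurable A by rewrite AE; exact: measurableI.
have mB : measurable B by rewrite BE; apply: fin_bigcap_measurable.
have BA : B `<=` A.
  rewrite AE => w Bw; split; rewrite /G /=.
    by have := Bw i; rewrite tnth_mktuple eqxx.
  by have := Bw j; rewrite tnth_mktuple eqxx eq_sym (negbTE ij).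
have ABnull : P (A `\` B) = 0%E.
  apply/(negligibleP _ (measurableD mA mB)).
  apply: (@negligibleS _ _ _ _ (\big[setU/set0]_(k < d) ~` G k 1)).
    move=> w [Aw nBw]; rewrite -bigcup_seq.
    have [k nk] : exists k, ~ tnth U k w <= 1.
      apply/existsNP => U1; apply: nBw => k; rewrite tnth_mktuple.
      move: Aw; rewrite AE => -[wi wj].
      by case: eqP => [->//|_]; case: eqP => [->//|_].
    by exists k => //=; rewrite mem_index_enum.
  by apply: big_ind => [||k _]; [exact: negligible_set0 | exact: negligibleU
    | exact: null].
by rewrite [LHS](measureDI P mA mB) [X in (X + _)%E]ABnull add0e setIidr.
Qed.

Lemma is_copula_margin2 (R : realType) (d : nat) (C : d.-tuple R -> R)
    (i j : 'I_d) :
  is_copula C -> i != j -> is_copula (margin2 C i j).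
Proof.
move=> [dsp [Om [P [U [unifU UC]]]]] ij.
exists dsp, Om, P, [tuple tnth U i; tnth U j]; split; last exact: margin2P.
move=> k; case: (unliftP ord0 k) => [l ->|->]; last exact: unifU.
by rewrite (ord1 l) (_ : lift _ _ = ord_max); [exact: unifU | apply: val_inj].
Qed.

Definition compatible (R : realType) (d : nat)
    (kappa : (2.-tuple R -> R) -> R) : set 'M[R]_d :=
  [set A | exists2 C : d.-tuple R -> R, is_copula C &
     A = \matrix_(i, j) kappa (if i == j then copM else margin2 C i j)].

Definition elliptope (R : realType) (d : nat) : set 'M[R]_d :=
  [set A | [/\ A^T = A,
               forall x : 'cV[R]_d, 0 <= (x^T *m A *m x) 0 0 &
               forall i, A i i = 1]].

Definition pearson (R : realType) (dsp : measure_display)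
    (Om : measurableType dsp) (P : probability Om R) (X Y : {RV P >-> R}) : R :=
  fine (covariance P X Y) /
    (Num.sqrt (fine 'V_P[X]) * Num.sqrt (fine 'V_P[Y])).

Definition cut_polytope (R : realType) (d : nat) : set 'M[R]_d :=
  [set A | exists (dsp : measure_display) (Om : measurableType dsp)
                  (P : probability Om R) (X : d.-tuple {RV P >-> R}),
     (forall i, P (tnth X i @^-1` [set 0]) = (2^-1)%:E /\
                P (tnth X i @^-1` [set 1]) = (2^-1)%:E) /\
     A = \matrix_(i, j) pearson (tnth X i) (tnth X j)].

Arguments compatible {R} d kappa _.
Arguments elliptope R d _ : clear implicits.
Arguments cut_polytope R d _ : clear implicits.

(* Main.v *)
(* Let I(C) be the integral of C - Pi with respect to mu, so that
   gamma C = I(C) / I(M).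

   Upper inclusion: by invariance, 4 I(C) is the integral of the sum of C - Pi
   over the orbit of a point under the two reflections.  On the diagonals this
   orbit is {t, 1 - t}^2, and if (U, V) ~ C the sum is the covariance of g(U)
   and g(V), with g = 1_[0, t] + 1_[0, 1 - t]; such covariances form a positive
   semi-definite matrix.

   Lower inclusion: given symmetric Bernoulli variables X_i, let U be uniform
   and independent of them and put U_i = U if X_i = 1 and U_i = 1 - U
   otherwise.  The (i, j)-margin is p M + (1 - p) W, where p = P(X_i = X_j) and
   W is the lower Frechet bound.  As I(W) = - I(M), its gamma is 2 p - 1, which
   is the Pearson correlation of X_i and X_j. *)
From HB Require Import structures.
Require Import Defs.
From mathcomp Require Import all_boot all_order all_algebra.
From mathcomp Require Import all_classical all_reals all_analysis.
From mathcomp Require Import measurable_realfun ring lra.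

Set Implicit Arguments.
Unset Strict Implicit.
Unset Printing Implicit Defensive.

Import Order.TTheory GRing.Theory Num.Theory.
Import numFieldNormedType.Exports.

Local Open Scope classical_set_scope.
Local Open Scope ring_scope.

(** * Change of variables under a measure-preserving map *)

Section invariant_integral.
Context d (T : measurableType d) (R : realType).
Variables (mu : {measure set T -> \bar R}) (D : set T) (xi : T -> T).
Hypotheses (mD : measurable D) (mxi : measurable_fun setT xi).
Hypothesis xiD : xi @^-1` D = D.
Hypothesis muxi : forall A, measurable A -> A `<=` D -> mu (xi @^-1` A) = mu A.

(** The pushforward of [mu] under [xi] coincides with [mu] on the measurable subsets of [D], so
    composing with [xi] does not change the integral of the absolute value over [D]. *)
Lemma invariant_integrable (f : T -> \bar R) :
  mu.-integrable D f -> mu.-integrable D (f \o xi).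
Proof.
move=> /integrableP[mf intf]; apply/integrableP; split.
  by apply: (measurable_comp mD) => //; [rewrite -{1}xiD => _ [x Dx <-] |
    exact: measurable_funTS].
rewrite -{1}xiD -(ge0_integral_pushforward mxi _ mD (f := fun x => `|f x|%E))//.
- by rewrite (eq_measure_integral mu).
- exact: measurableT_comp.
Qed.

Lemma invariant_integralE (f : T -> \bar R) :
  mu.-integrable D f ->
  (\int[mu]_(x in D) (f \o xi) x = \int[mu]_(x in D) f x)%E.
Proof.
move=> intf; have /integrableP[mf _] := intf.
(* The change of variables asks for measurability on the whole space, while [f] is measurable on [D]
   only: extend it by zero. *)
have mfD : measurable_fun setT (f \_ D) by apply/(measurable_restrictT _ mD).
have fD : {in D, f =1 f \_ D} by move=> x xD; rewrite patchE xD.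
transitivity (\int[mu]_(x in xi @^-1` D) ((f \_ D) \o xi) x)%E.
  rewrite xiD; apply: eq_integral => x xD /=; apply: fD.
  by move: xD; rewrite !inE -{1}xiD.
rewrite -(integral_pushforward mxi mfD _ mD).
  rewrite (eq_measure_integral mu)//.
  by apply: eq_integral => x /fD.
rewrite xiD; apply: invariant_integrable.
by apply: eq_integrable intf.
Qed.

Lemma invariant_Rintegral (f : T -> R) :
  mu.-integrable D (EFin \o f) ->
  \int[mu]_(x in D) f (xi x) = \int[mu]_(x in D) f x.
Proof. by move=> /invariant_integralE; rewrite /Rintegral /= => ->. Qed.

End invariant_integral.

(** * Real-valued integrals: finite sums and almost everywhere nonnegative integrands *)

Lemma Rintegral_sum d (T : measurableType d) (R : realType)
    (mu : {measure set T -> \bar R}) (D : set T) (I : finType)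
    (f : I -> T -> R) : measurable D ->
  (forall i, mu.-integrable D (EFin \o f i)) ->
  \int[mu]_(x in D) (\sum_i f i x) = \sum_i \int[mu]_(x in D) f i x.
Proof.
move=> mD intf; rewrite /Rintegral.
under eq_integral do rewrite -sumEFin.
rewrite integral_sum//; rewrite -sum_fine// => i _.
exact: (integrable_fin_num mD (intf i)).
Qed.

Lemma integrable_EFinZl d (T : measurableType d) (R : realType)
    (mu : {measure set T -> \bar R}) (D : set T) (k : R) (f : T -> R) :
  measurable D -> mu.-integrable D (EFin \o f) ->
  mu.-integrable D (EFin \o (fun x => k * f x)).
Proof.
move=> mD intf.
have -> : EFin \o (fun x => k * f x) = (fun x => (k%:E * (EFin \o f) x)%E).
  by [].
exact: integrableZl.
Qed.

Lemma integrable_EFin_sum d (T : measurableType d) (R : realType)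
    (mu : {measure set T -> \bar R}) (D : set T) (I : finType)
    (f : I -> T -> R) : measurable D ->
  (forall i, mu.-integrable D (EFin \o f i)) ->
  mu.-integrable D (EFin \o (fun x => \sum_i f i x)).
Proof.
move=> mD intf.
have -> : EFin \o (fun x => \sum_i f i x) =
    (fun x => (\sum_i (EFin \o f i) x)%E).
  by apply/funext => x /=; rewrite sumEFin.
exact: integrable_sum.
Qed.

(** Meant for [N] the part of the open square off the two diagonals. *)
Lemma ae_Rintegral_ge0 d (T : measurableType d) (R : realType)
    (mu : {measure set T -> \bar R}) (D N : set T) (f : T -> R) :
  measurable D -> measurable N -> mu N = 0%E ->
  mu.-integrable D (EFin \o f) ->
  (forall x, D x -> ~ N x -> 0 <= f x) ->
  0 <= \int[mu]_(x in D) f x.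
Proof.
move=> mD mN N0 intf f0; rewrite /Rintegral (negligible_integral mN)//.
by apply: fine_ge0; apply: integral_ge0 => x [Dx Nx]; rewrite lee_fin f0.
Qed.

(** * Gram matrices of indicator functions *)

Section gram.
Context d (T : measurableType d) (R : realType) (P : probability T R).

Lemma Rintegral_indic (A : set T) : measurable A ->
  \int[P]_x \1_A x = fine (P A).
Proof. by move=> mA; rewrite /Rintegral integral_indic// setIT. Qed.

(* The form is the integral of the square of [\sum_i a i * \1_(A i)]. *)
Lemma gram_prob_ge0 (I : finType) (a : I -> R) (A : I -> set T) :
  (forall i, measurable (A i)) ->
  0 <= \sum_i \sum_j a i * a j * fine (P (A i `&` A j)).
Proof.
move=> mA.
have mAA i j : measurable (A i `&` A j) by exact: measurableI.
have intA i j : P.-integrable setT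
    (EFin \o (fun x => a i * a j * \1_(A i `&` A j) x)).
  by apply: integrable_EFinZl => //; exact: integrable_indic.
suff -> : \sum_i \sum_j a i * a j * fine (P (A i `&` A j)) =
    \int[P]_x (\sum_i a i * \1_(A i) x) ^+ 2.
  by apply: Rintegral_ge0 => x _; exact: sqr_ge0.
transitivity (\int[P]_x
    (\sum_i \sum_j a i * a j * (\1_(A i `&` A j) x))).
  rewrite Rintegral_sum//; last by move=> i; exact: integrable_EFin_sum.
  apply: eq_bigr => i _; rewrite Rintegral_sum//; apply: eq_bigr => j _.
  rewrite RintegralZl//; first by rewrite Rintegral_indic.
  exact: integrable_indic.
apply: eq_Rintegral => x _; rewrite expr2 big_distrlr /=.
apply: eq_bigr => i _; apply: eq_bigr => j _.
by rewrite indicI /=; ring.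
Qed.

End gram.

(** * Bivariate copulas: Frechet bounds and measurability *)

Section bivariate.
Context (R : realType).
Implicit Types (C : 2.-tuple R -> R) (s t : R) (x : R * R).

Lemma cube2P s t : 0 <= s <= 1 -> 0 <= t <= 1 -> cube 2 [tuple s; t].
Proof.
move=> s01 t01 i; case: (unliftP ord0 i) => [j ->|-> //].
by rewrite (ord1 j).
Qed.

Lemma has_df2E dsp (Om : measurableType dsp) (P : probability Om R)
    (U V : {RV P >-> R}) C s t :
  has_df [tuple U; V] C -> 0 <= s <= 1 -> 0 <= t <= 1 ->
  P (U @^-1` `]-oo, s] `&` V @^-1` `]-oo, t]) = (C [tuple s; t])%:E.
Proof.
move=> UV s01 t01; rewrite -(UV _ (cube2P s01 t01)); congr (P _).
apply/seteqP; split => w /=; rewrite !in_itv/=.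
  by move=> [Us Vt] i; case: (unliftP ord0 i) => [j ->|-> //]; rewrite (ord1 j).
by move=> UVw; split; [exact: (UVw ord0) | exact: (UVw ord_max)].
Qed.

Lemma is_copula2 C : is_copula C ->
  exists (dsp : measure_display) (Om : measurableType dsp)
         (P : probability Om R) (U V : {RV P >-> R}),
    [/\ std_uniform U, std_uniform V & has_df [tuple U; V] C].
Proof.
move=> [dsp [Om [P [U [unifU UC]]]]].
exists dsp, Om, P, (tnth U ord0), (tnth U ord_max); split => //.
suff <- : U = [tuple tnth U ord0; tnth U ord_max] by [].
apply: eq_from_tnth => i; case: (unliftP ord0 i) => [j ->|-> //].
by rewrite (ord1 j) (_ : lift _ _ = ord_max)//; exact: val_inj.
Qed.

(** Upper Frechet bound: the joint event lies in each of the two marginal events. *)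
Lemma copula_le_copM C s t : is_copula C -> 0 <= s <= 1 -> 0 <= t <= 1 ->
  C [tuple s; t] <= Num.min s t.
Proof.
move=> /is_copula2[dsp [Om [P [U [V [uU uV UV]]]]]] s01 t01.
rewrite le_min -!lee_fin -(has_df2E UV)// -(uU s)// -(uV t)//.
have mU : measurable (U @^-1` `]-oo, s]) by exact: measurable_funPTI.
have mV : measurable (V @^-1` `]-oo, t]) by exact: measurable_funPTI.
have mUV := measurableI _ _ mU mV.
apply/andP; split; apply: le_measure; rewrite ?inE//.
Qed.

(** Lower Frechet bound W, by inclusion-exclusion: the union of the two marginal events has
    probability at most 1. *)
Lemma copula_ge C s t : is_copula C -> 0 <= s <= 1 -> 0 <= t <= 1 ->
  Num.max 0 (s + t - 1) <= C [tuple s; t].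
Proof.
move=> /is_copula2[dsp [Om [P [U [V [uU uV UV]]]]]] s01 t01.
have mU : measurable (U @^-1` `]-oo, s]) by exact: measurable_funPTI.
have mV : measurable (V @^-1` `]-oo, t]) by exact: measurable_funPTI.
rewrite ge_max -!lee_fin -(has_df2E UV)// measure_ge0/=.
have := probability_le1 P (measurableU _ _ mU mV).
rewrite measureUfinl ?ltey_eq ?fin_num_measure//.
rewrite [X in (X + _ - _)%E](uU s s01) [X in (_ + X - _)%E](uV t t01).
rewrite [X in (_ - X)%E](has_df2E UV)//.
move=> stC; have : s + t - C [tuple s; t] <= 1 by rewrite -lee_fin; exact: stC.
by rewrite (has_df2E UV)// lee_fin; lra.
Qed.

Definition excess C x := C [tuple x.1; x.2] - copPi [tuple x.1; x.2].

Lemma measurable_open_square : measurable (@open_square R).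
Proof. exact: measurableX. Qed.

Lemma open_squareP x : open_square x -> 0 <= x.1 <= 1 /\ 0 <= x.2 <= 1.
Proof.
rewrite /open_square /= !in_itv/= => -[/andP[x0 x1] /andP[y0 y1]].
by rewrite !ltW.
Qed.

(* The distribution function of [(U, V)] at [(s, t)] is the measure of the
   section at [(s, t)] of a measurable subset of [(R * R) * Om]. *)
Lemma measurable_copula C : is_copula C ->
  measurable_fun open_square (fun x : R * R => C [tuple x.1; x.2]).
Proof.
move=> /is_copula2[dsp [Om [P [U [V [_ _ UV]]]]]].
pose E := [set z : R * R * Om | U z.2 <= z.1.1] `&`
          [set z : R * R * Om | V z.2 <= z.1.2].
have mE : measurable E.
  rewrite -[E]setTI setIA; apply: measurableI; last first.
    rewrite -[X in measurable X]setTI; apply: measurable_fun_le => //.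
      by apply: measurableT_comp => //; exact: measurableT_comp.
    by apply: measurableT_comp => //; exact: measurableT_comp.
  apply: measurable_fun_le => //.
    by apply: measurableT_comp => //; exact: measurableT_comp.
  by apply: measurableT_comp => //; exact: measurableT_comp.
apply/measurable_EFinP.
apply: (eq_measurable_fun (P \o xsection E)) => [x|].
  rewrite inE => /open_squareP[x0 y0]; rewrite /= -(has_df2E UV)//.
  by congr (P _); apply/seteqP; split => w;
    rewrite /xsection /E /= inE/= !in_itv.
by apply: measurable_funTS; exact: measurable_fun_xsection.
Qed.

Lemma measurable_copPi :
  measurable_fun setT (fun x : R * R => copPi [tuple x.1; x.2]).
Proof. exact: (measurable_funM measurable_fst measurable_snd). Qed.

Lemma measurable_copM :
  measurable_fun setT (fun x : R * R => copM [tuple x.1; x.2]).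
Proof. exact: (measurable_minr measurable_fst measurable_snd). Qed.

Lemma excess_copM_ge0 x : open_square x -> 0 <= excess copM x.
Proof.
move=> /open_squareP[/andP[x0 x1] /andP[y0 y1]].
rewrite /excess /copM /copPi /tnth /= subr_ge0 le_min.
by rewrite ler_piMr// ler_piMl.
Qed.

(** The right-hand side is Pi - W, so reflecting the second coordinate exchanges M - Pi and Pi -
    W. *)
Lemma excess_copM_sigma2 x :
  excess copM (sigma2 x) = x.1 * x.2 - Num.max 0 (x.1 + x.2 - 1).
Proof.
rewrite /excess /copM /copPi /tnth /sigma2 /=.
by case: x => s t /=; rewrite minElt maxElt;
  case: (ltP s (1 - t)) => h1; case: (ltP 0 (s + t - 1)) => h2; nra.
Qed.

(** The Frechet bounds place C - Pi between W - Pi and M - Pi, and both terms of the sum are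
    nonnegative. The sum serves as a dominating function. *)
Lemma excess_le C x : is_copula C -> open_square x ->
  `|excess C x| <= excess copM x + excess copM (sigma2 x).
Proof.
move=> copC Dx; have [x0 y0] := open_squareP Dx.
have := copula_le_copM copC x0 y0; have := copula_ge copC x0 y0.
have := excess_copM_ge0 Dx.
have : 0 <= excess copM (sigma2 x).
  apply: excess_copM_ge0; move: Dx; rewrite /open_square /sigma2 /=.
  by rewrite !in_itv/= => -[-> ?]; split => //; lra.
rewrite excess_copM_sigma2 /excess /copM /copPi /tnth /= => *.
by rewrite ler_norml; lra.
Qed.

End bivariate.

Lemma measurable_eqr d (T : measurableType d) (R : realType) (f g : T -> R) :
  measurable_fun setT f -> measurable_fun setT g ->
  measurable [set x | f x = g x].
Proof.
move=> mf mg; rewrite (_ : mkset _ = (fun x => f x == g x) @^-1` [set true]).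
  by rewrite -[X in measurable X]setTI; exact: measurable_fun_eqr.
by apply/seteqP; split => x /= /eqP.
Qed.

(** * Integrals of C - Pi with respect to an admissible measure *)

Section concordance_integral.
Context (R : realType) (mu : {measure set (R * R) -> \bar R}).
Hypothesis admmu : admissible mu.
Implicit Types (C : 2.-tuple R -> R) (f : R * R -> R).

Let D := @open_square R.
Let mD : measurable D := @measurable_open_square R.

Lemma sigma1K : involutive (@sigma1 R).
Proof. by case=> s t; rewrite /sigma1 /= subKr. Qed.

Lemma sigma2K : involutive (@sigma2 R).
Proof. by case=> s t; rewrite /sigma2 /= subKr. Qed.

Lemma sigma1_open_square (x : R * R) : open_square x -> open_square (sigma1 x).
Proof.
case: x => s t [] /=; rewrite !in_itv/= => *.
by split => //=; rewrite in_itv/=; lra.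
Qed.

Lemma sigma2_open_square (x : R * R) : open_square x -> open_square (sigma2 x).
Proof.
case: x => s t [] /=; rewrite !in_itv/= => *.
by split => //=; rewrite in_itv/=; lra.
Qed.

Lemma measurable_sigma1 : measurable_fun setT (@sigma1 R).
Proof.
apply: measurable_fun_pair => //=.
exact: (measurable_funB (measurable_cst _) measurable_fst).
Qed.

Lemma measurable_sigma2 : measurable_fun setT (@sigma2 R).
Proof.
apply: measurable_fun_pair => //=.
exact: (measurable_funB (measurable_cst _) measurable_snd).
Qed.

Section symmetry.
Variable xi : R * R -> R * R.
Hypotheses (D4xi : D4 xi) (xiK : involutive xi).
Hypothesis xiD : forall x, D x -> D (xi x).
Hypothesis mxi : measurable_fun setT xi.

Let preimage_xi : xi @^-1` D = D.
Proof.
apply/seteqP; split => x; last exact: xiD.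
by move=> /xiD; rewrite xiK.
Qed.

(** Since [xi] is an involution, images are preimages; this puts the invariance in [admissible] into
    the form needed for pushforwards. *)
Let mu_preimage_xi A : measurable A -> A `<=` D -> mu (xi @^-1` A) = mu A.
Proof.
move=> mA AD; rewrite -(admmu.1 _ _ D4xi mA AD); congr (mu _).
apply/seteqP; split => x /=; first by move=> Ax; exists (xi x).
by move=> [y Ay <-]; rewrite xiK.
Qed.

Lemma symmetry_integrable f : mu.-integrable D (EFin \o f) ->
  mu.-integrable D (EFin \o (f \o xi)).
Proof. exact: invariant_integrable. Qed.

Lemma symmetry_Rintegral f : mu.-integrable D (EFin \o f) ->
  \int[mu]_(x in D) f (xi x) = \int[mu]_(x in D) f x.
Proof. exact: invariant_Rintegral. Qed.

End symmetry.

Lemma D4_sigma1 : D4 (@sigma1 R).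
Proof. by do 5 left; right. Qed.

Lemma D4_sigma2 : D4 (@sigma2 R).
Proof. by do 4 left; right. Qed.

Lemma integrable_sigma1 f : mu.-integrable D (EFin \o f) ->
  mu.-integrable D (EFin \o (f \o sigma1)).
Proof.
exact: (symmetry_integrable D4_sigma1 sigma1K sigma1_open_square
  measurable_sigma1).
Qed.

Lemma integrable_sigma2 f : mu.-integrable D (EFin \o f) ->
  mu.-integrable D (EFin \o (f \o sigma2)).
Proof.
exact: (symmetry_integrable D4_sigma2 sigma2K sigma2_open_square
  measurable_sigma2).
Qed.

Lemma Rintegral_sigma1 f : mu.-integrable D (EFin \o f) ->
  \int[mu]_(x in D) f (sigma1 x) = \int[mu]_(x in D) f x.
Proof.
exact: (symmetry_Rintegral D4_sigma1 sigma1K sigma1_open_square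
  measurable_sigma1).
Qed.

Lemma Rintegral_sigma2 f : mu.-integrable D (EFin \o f) ->
  \int[mu]_(x in D) f (sigma2 x) = \int[mu]_(x in D) f x.
Proof.
exact: (symmetry_Rintegral D4_sigma2 sigma2K sigma2_open_square
  measurable_sigma2).
Qed.

(** M - Pi is nonnegative on the open square, so the finiteness in [admissible] amounts to
    integrability. *)
Lemma integrable_excess_copM : mu.-integrable D (EFin \o excess copM).
Proof.
apply/integrableP; split.
  apply/measurable_EFinP/measurable_funTS.
  exact: (measurable_funB (@measurable_copM R) (@measurable_copPi R)).
case: admmu => _ /andP[_]; apply: le_lt_trans.
rewrite le_eqVlt; apply/orP; left; apply/eqP; apply: eq_integral => x /=.
by rewrite inE => /excess_copM_ge0 ex0; rewrite ger0_norm.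
Qed.

Lemma excess_copM_gt0 : 0 < \int[mu]_(x in D) excess copM x.
Proof. by case: admmu => _ intM; rewrite /Rintegral fine_gt0. Qed.

(** Domination by the bound of [excess_le], whose second term is integrable by invariance under
    [sigma2]. *)
Lemma integrable_excess C : is_copula C ->
  mu.-integrable D (EFin \o excess C).
Proof.
move=> copC; pose g x := @excess R copM x + excess copM (sigma2 x).
apply: (le_integrable mD (g := EFin \o g)).
- apply/measurable_EFinP/measurable_funB; first exact: measurable_copula.
  by apply: measurable_funTS; exact: measurable_copPi.
- move=> x Dx /=; rewrite lee_fin [leRHS]ger0_norm; first exact: excess_le.
  by rewrite addr_ge0// excess_copM_ge0//; exact: sigma2_open_square.
- have -> : EFin \o g =
      ((EFin \o excess copM) \+ (EFin \o (excess copM \o sigma2)))%E by [].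
  apply: integrableD => //; first exact: integrable_excess_copM.
  exact/integrable_sigma2/integrable_excess_copM.
Qed.

(** The hypothesis says that C = p M + (1 - p) W on the open square. Invariance under [sigma2] gives
    I(W) = - I(M), whence the factor p - (1 - p). *)
Lemma Rintegral_excess_mixture C p :
  (forall x, D x -> excess C x =
    p * excess copM x - (1 - p) * excess copM (sigma2 x)) ->
  \int[mu]_(x in D) excess C x =
  (2 * p - 1) * \int[mu]_(x in D) excess copM x.
Proof.
move=> EC; have intM := integrable_excess_copM.
have intM2 : mu.-integrable D (EFin \o (fun x => excess copM (sigma2 x))).
  exact: integrable_sigma2.
rewrite (@eq_Rintegral _ _ _ mu D (fun x =>
  p * excess copM x - (1 - p) * excess copM (sigma2 x))); last first.
  by move=> x; rewrite inE => /EC.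
rewrite RintegralB//; try exact: integrable_EFinZl.
by rewrite !RintegralZl// Rintegral_sigma2//; ring.
Qed.

Hypothesis diag :
  mu (open_square `\` [set x | x.1 = x.2 \/ x.1 + x.2 = 1]) = 0%E.

(** Summing [f] over the four products of [sigma1] and [sigma2] multiplies the integral by 4.
    Outside a null set the point lies on a diagonal, where this sum is the one assumed
    nonnegative. *)
Lemma symmetrized_Rintegral_ge0 f : mu.-integrable D (EFin \o f) ->
  (forall t, 0 <= t <= 1 ->
    0 <= f (t, t) + f (1 - t, t) + f (t, 1 - t) + f (1 - t, 1 - t)) ->
  0 <= \int[mu]_(x in D) f x.
Proof.
move=> intf f0.
have int1 := integrable_sigma1 intf.
have int2 := integrable_sigma2 intf.
have int12 := integrable_sigma2 int1.
pose g x := (f x + f (sigma1 x)) + (f (sigma2 x) + f (sigma1 (sigma2 x))).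
have addint f1 f2 : mu.-integrable D (EFin \o f1) ->
    mu.-integrable D (EFin \o f2) ->
    mu.-integrable D (EFin \o (fun x => f1 x + f2 x)).
  by move=> i1 i2; have := integrableD mD i1 i2.
have intfg : \int[mu]_(x in D) g x = 4 * \int[mu]_(x in D) f x.
  rewrite /g RintegralD//; try exact: addint.
  rewrite RintegralD// RintegralD// Rintegral_sigma1// Rintegral_sigma2//.
  rewrite (Rintegral_sigma2 (f := f \o sigma1))// Rintegral_sigma1//.
  by ring.
rewrite -(pmulr_rge0 _ (ltr0n _ 4)) -intfg.
apply: (ae_Rintegral_ge0 mD _ diag).
- apply: measurableD => //; apply: measurableU.
    exact: measurable_eqr measurable_fst measurable_snd.
  apply: measurable_eqr; last exact: measurable_cst.
  exact: measurable_funD measurable_fst measurable_snd.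
- by apply: (addint _ _) => //; exact: addint.
- move=> [s t] Dx; rewrite /g /sigma1 /sigma2 /=.
  move=> /not_andP[//|]; rewrite /= notK => st.
  have := open_squareP Dx => -[/= s01 t01].
  case: st => st.
    by subst t; have := f0 _ s01; lra.
  (* On the antidiagonal the orbit of (1 - t, t) consists of the same four points in another
     order. *)
  have -> : s = 1 - t by lra.
  by rewrite subKr; have := f0 _ t01; lra.
Qed.

End concordance_integral.

(** * Upper inclusion: positive semi-definiteness *)

Lemma has_df_copM (R : realType) dsp (Om : measurableType dsp)
    (P : probability Om R) (U : {RV P >-> R}) :
  std_uniform U -> has_df [tuple U; U] copM.
Proof.
move=> unifU u u01; rewrite /copM -unifU; last first.
  by rewrite minElt; case: ifP => _; exact: u01.
congr (P _); apply/seteqP; split => w /=; rewrite in_itv/= le_min.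
  by move=> Uw; apply/andP; split; [exact: (Uw ord0) | exact: (Uw ord_max)].
move=> /andP[Uw0 Uw1] i; case: (unliftP ord0 i) => [j ->|-> //].
by rewrite (ord1 j) (_ : lift _ _ = ord_max)//; exact: val_inj.
Qed.

(* Gram inequality for the variables
   [\1_(U i <= t) + \1_(U i <= 1 - t) - 1], which are centered as [U i] is
   uniform. *)
Lemma symmetrized_gram_ge0 (R : realType) dsp (Om : measurableType dsp)
    (P : probability Om R) (n : nat) (U : 'I_n -> {RV P >-> R})
    (K : 'I_n -> 'I_n -> 2.-tuple R -> R) (a : 'I_n -> R) (t : R) :
  (forall i, std_uniform (U i)) ->
  (forall i j, has_df [tuple U i; U j] (K i j)) -> 0 <= t <= 1 ->
  0 <= \sum_i \sum_j a i * a j *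
    (K i j [tuple t; t] + K i j [tuple 1 - t; t] + K i j [tuple t; 1 - t]
     + K i j [tuple 1 - t; 1 - t] - 1).
Proof.
move=> unifU UK t01.
have t01' : 0 <= 1 - t <= 1 by lra.
(* The index in ['I_3] runs over the three terms of the centered variable; the constant -1 is the
   indicator of [setT] with coefficient -1. *)
pose A (p : 'I_n * 'I_3) : set Om := match val p.2 with
  | 0%N => U p.1 @^-1` `]-oo, t] | 1%N => U p.1 @^-1` `]-oo, 1 - t]
  | _ => setT end.
pose c (k : 'I_3) : R := if val k == 2%N then -1 else 1.
have mA p : measurable (A p).
  by rewrite /A; case: (val p.2) => [|[|_]] //; exact: measurable_funPTI.
have := gram_prob_ge0 P (fun p => a p.1 * c p.2) mA.
congr (_ <= _).
rewrite -(pair_bigA _ (fun i k => \sum_q a i * c k * (a q.1 * c q.2) *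
  fine (P (A (i, k) `&` A q)))) /=.
apply: eq_bigr => i _.
under eq_bigr do rewrite -(pair_bigA _ (fun j l => a i * c _ * (a j * c l) *
  fine (P (A (i, _) `&` A (j, l))))) /=.
rewrite exchange_big /=; apply: eq_bigr => j _.
rewrite !big_ord_recl !big_ord0 /A /c /= !setTI !setIT.
have fU k s : 0 <= s <= 1 -> fine (P (U k @^-1` `]-oo, s])) = s.
  by move=> s01; rewrite [X in fine X](unifU k s s01).
have fK s s' : 0 <= s <= 1 -> 0 <= s' <= 1 ->
    fine (P (U i @^-1` `]-oo, s] `&` U j @^-1` `]-oo, s'])) =
    K i j [tuple s; s'].
  by move=> s01 s01'; rewrite (has_df2E (UK i j)).
(* The products with the constant term add up to - 2 (t + (1 - t)) + 1 = -1. *)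
rewrite !fK// !fU// [X in fine X]probability_setT /=.
by ring.
Qed.

Lemma compatible_subset_elliptope (R : realType) (d : nat)
    (gamma : (2.-tuple R -> R) -> R) :
  generalized_gini gamma -> compatible d gamma `<=` elliptope R d.
Proof.
move=> [mocg [mu [admmu diag gammaE]]] _ [C copC ->].
have [dsp [Om [P [U [unifU UC]]]]] := copC.
(* On the diagonal [copM] is the distribution function of the pair (U_i, U_i), so all entries can be
   treated alike. *)
pose K (i j : 'I_d) := if i == j then copM else margin2 C i j.
have UK i j : has_df [tuple tnth U i; tnth U j] (K i j).
  rewrite /K; case: (eqVneq i j) => [->|ij]; first exact: has_df_copM.
  exact: margin2P.
have copK i j : is_copula (K i j).
  exists dsp, Om, P, [tuple tnth U i; tnth U j]; split; last exact: UK.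
  move=> k; case: (unliftP ord0 k) => [l ->|->]; last exact: unifU.
  by rewrite (ord1 l) (_ : lift _ _ = ord_max); [exact: unifU | exact: val_inj].
split.
- apply/matrixP => i j; rewrite !mxE.
  exact: (concordance_sym mocg (copK i j) (copK j i) (UK i j) (UK j i)).
- move=> x; rewrite !mxE.
  (* Pointwise quadratic form: its integral divided by I(M) is the quadratic form of the matrix of
     gammas. *)
  pose f z := \sum_i \sum_j x i 0 * x j 0 * excess (K i j) z.
  have intf i j : mu.-integrable open_square
      (EFin \o (fun z => x i 0 * x j 0 * excess (K i j) z)).
    apply: integrable_EFinZl; first exact: measurable_open_square.
    exact: integrable_excess.
  have intf1 i : mu.-integrable open_square
      (EFin \o (fun z => \sum_j x i 0 * x j 0 * excess (K i j) z)).
    by apply: integrable_EFin_sum => //; exact: measurable_open_square.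
  have f_ge0 : 0 <= \int[mu]_(z in open_square) f z.
    apply: symmetrized_Rintegral_ge0 => //.
      by apply: integrable_EFin_sum => //; exact: measurable_open_square.
    (* Over the four points of the orbit Pi sums to (t + (1 - t))^2 = 1, the constant subtracted in
       the Gram inequality. *)
    move=> t t01; have := symmetrized_gram_ge0 (fun i => x i 0)
      unifU UK t01.
    congr (_ <= _); rewrite /f -!big_split /=; apply: eq_bigr => i _.
    rewrite -!big_split /=; apply: eq_bigr => j _.
    rewrite /excess /copPi /tnth /=; ring.
  suff -> : \sum_j (x^T *m \matrix_(i, j) gamma (K i j)) 0 j * x j 0 =
      (\int[mu]_(z in open_square) f z) /
      (\int[mu]_(z in open_square) excess copM z).
    by rewrite divr_ge0// ltW// excess_copM_gt0.
  rewrite /f Rintegral_sum//; last exact: measurable_open_square.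
  under [in RHS]eq_bigr => i _.
    rewrite Rintegral_sum//; last exact: measurable_open_square.
    over.
  rewrite exchange_big mulr_suml; apply: eq_bigr => j _ /=.
  rewrite mxE !mulr_suml; apply: eq_bigr => i _.
  rewrite RintegralZl//; last exact: integrable_excess.
    rewrite !mxE gammaE//= /excess; ring.
  exact: measurable_open_square.
- by move=> i; rewrite mxE eqxx; exact: concordance_norm.
Qed.

(** * A uniform variable and its reflection *)

Section uniform_reflection.
Context (R : realType).

Let Q := uniform_prob (@ltr01 R).

(** The uniform law sees only the part of [A] in [0, 1]. The maximum covers the empty interval, when
    b < a. *)
Lemma uniform_prob01_itv (A : set R) (a b : R) :
  measurable A -> A `&` `[0, 1] = `[a, b]%classic ->
  Q A = (Num.max 0 (b - a))%:E.
Proof.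
move=> mA Aab; rewrite /Q /uniform_prob integral_uniform_pdf Aab.
rewrite (eq_integral (cst 1%E)) => [|x]; last first.
  rewrite inE -Aab => -[_ /=]; rewrite in_itv/= /uniform_pdf => ->.
  by rewrite subr0 invr1.
rewrite integral_cst// mul1e/= lebesgue_measure_itv/= lte_fin maxElt subr_gt0.
by case: ifP => //; rewrite EFinB.
Qed.

Definition reflect_unless (b : bool) (u : R) := if b then u else 1 - u.

Lemma measurable_reflect_unless b : measurable_fun setT (reflect_unless b).
Proof.
rewrite /reflect_unless; case: b => /=; first exact: measurable_id.
by apply: measurable_funB.
Qed.

(** Within [0, 1] the event is an interval: [0, min s t] or [1 - min s t, 1] if [b] and [c] are
    equal, [1 - t, s] or [1 - s, t] otherwise. The lengths are the values of M and W. *)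
Lemma uniform_prob_reflect_unless (b c : bool) (s t : R) :
  0 <= s <= 1 -> 0 <= t <= 1 ->
  Q ([set u | reflect_unless b u <= s] `&` [set u | reflect_unless c u <= t]) =
  (if b == c then Num.min s t else Num.max 0 (s + t - 1))%:E.
Proof.
move=> s01 t01.
have mI : measurable ([set u | reflect_unless b u <= s] `&`
                      [set u | reflect_unless c u <= t]).
  apply: measurableI; rewrite -[X in measurable X]setTI;
  by apply: measurable_fun_le => //; exact: measurable_reflect_unless.
have QE a a' r : Num.max 0 (a' - a) = r ->
    (forall u, [&& reflect_unless b u <= s, reflect_unless c u <= t,
                   0 <= u & u <= 1] = (a <= u <= a')) ->
    Q ([set u | reflect_unless b u <= s] `&`
       [set u | reflect_unless c u <= t]) = r%:E.
  move=> <- E; apply: uniform_prob01_itv => //.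
  apply/seteqP; split => u /=; rewrite !in_itv/= -E.
    by move=> [[-> ->] ->].
  by move=> /and4P[-> -> -> ->].
case: b c mI QE => -[] mI QE /=.
- apply: (QE 0 (Num.min s t)) => [|u].
    by rewrite subr0; apply/max_idPr; rewrite le_min; lra.
  by rewrite /reflect_unless le_min; lra.
- apply: (QE (1 - t) s) => [|u]; first by congr Num.max; lra.
  by rewrite /reflect_unless; lra.
- apply: (QE (1 - s) t) => [|u]; first by congr Num.max; lra.
  by rewrite /reflect_unless; lra.
- apply: (QE (1 - Num.min s t) 1) => [|u].
    by rewrite subKr; apply/max_idPr; rewrite le_min; lra.
  have -> : (1 - Num.min s t <= u) = (1 - u <= Num.min s t) by lra.
  by rewrite /reflect_unless le_min; lra.
Qed.

End uniform_reflection.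

(** * Product of two probabilities *)

Section product_probability.
Context d1 d2 (T1 : measurableType d1) (T2 : measurableType d2) (R : realType).
Variables (P : probability T1 R) (Q : probability T2 R).

Definition product_prob := (P \x Q)%E.

HB.instance Definition _ := Measure.on product_prob.

Let product_prob_setT : product_prob setT = 1%E.
Proof.
rewrite /product_prob -setXTT product_measure1E//.
rewrite [X in (X * _)%E]probability_setT.
by rewrite [X in (_ * X)%E]probability_setT mule1.
Qed.

HB.instance Definition _ :=
  Measure_isProbability.Build _ _ R product_prob product_prob_setT.

End product_probability.

(** * The copula of a uniform variable reflected by random signs *)

Section sign_copula.
Context (R : realType) dsp (Om : measurableType dsp) (P : probability Om R).
Variables (d : nat) (B : 'I_d -> set Om).
Hypothesis mB : forall i, measurable (B i).

Let PQ : probability _ R := product_prob P (uniform_prob (@ltr01 R)).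

(** If A and A' are the events X = 1 and Y = 1 for symmetric Bernoulli X and Y, this is the event X
    = Y up to a null set. *)
Definition agree (A A' : set Om) : set Om := (A `&` A') `|` (~` A `&` ~` A').

Lemma agreeE A A' w : (w \in agree A A') = ((w \in A) == (w \in A')).
Proof.
by rewrite /agree in_setU !in_setI !in_setC; case: (w \in A); case: (w \in A').
Qed.

Lemma agree_refl A : agree A A = setT.
Proof. by apply/seteqP; split => // w _; rewrite -inE agreeE eqxx. Qed.

Lemma measurable_agree A A' : measurable A -> measurable A' ->
  measurable (agree A A').
Proof.
by move=> mA mA'; apply: measurableU; apply: measurableI => //;
  exact: measurableC.
Qed.

(** The variable U_i: [B i] stands for the event X_i = 1 and the second coordinate for the
    independent uniform variable U. *)
Definition sign_rv (i : 'I_d) (z : Om * measurableTypeR R) : R :=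
  reflect_unless (z.1 \in B i) z.2.

Lemma measurable_sign_rv i : measurable_fun setT (sign_rv i).
Proof.
have -> : sign_rv i = fun z => if z.1 \in B i then z.2 else 1 - z.2.
  by apply/funext => z; rewrite /sign_rv /reflect_unless.
apply: measurable_fun_ifT.
- apply: (measurable_fun_bool true); rewrite setTI.
  rewrite (_ : _ @^-1` _ = B i `*` setT); first exact: measurableX.
  by apply/seteqP; split => z /=; [move=> /set_mem | move=> [+ _] => /mem_set].
- exact: measurable_snd.
- exact: (measurable_funB (measurable_cst _) measurable_snd).
Qed.

Let sign_mixin i := isMeasurableFun.Build _ _ _ _ _ (measurable_sign_rv i).

Definition sign_mfun i : {RV PQ >-> R} := HB.pack (sign_rv i) (sign_mixin i).

Lemma sign_rv_joint i j s t : 0 <= s <= 1 -> 0 <= t <= 1 ->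
  PQ (sign_mfun i @^-1` `]-oo, s] `&` sign_mfun j @^-1` `]-oo, t]) =
  (let p := fine (P (agree (B i) (B j))) in
   p * Num.min s t + (1 - p) * Num.max 0 (s + t - 1))%:E.
Proof.
move=> s01 t01 /=; set p := fine _.
pose S := agree (B i) (B j).
have mS : measurable S by exact: measurable_agree.
(* The product measure integrates the uniform measure of the sections, which is M on [S] and W off
   it. *)
transitivity (\int[P]_w (Num.max 0 (s + t - 1) +
    (Num.min s t - Num.max 0 (s + t - 1)) * \1_S w)%:E)%E.
  apply: eq_integral => w _ /=.
  rewrite [X in uniform_prob _ X](_ : _ =
    [set u | reflect_unless (w \in B i) u <= s] `&`
    [set u | reflect_unless (w \in B j) u <= t]).
    rewrite uniform_prob_reflect_unless// indicE /S agreeE.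
    by case: ifP => _; congr EFin => /=; ring.
  by apply/seteqP; split => u; rewrite /xsection /= inE/= !in_itv/=.
have intS : P.-integrable setT
    (EFin \o (fun w => (Num.min s t - Num.max 0 (s + t - 1)) * \1_S w)).
  by apply: integrable_EFinZl => //; exact: integrable_indic.
have intc : P.-integrable setT (EFin \o cst (Num.max 0 (s + t - 1))).
  exact: finite_measure_integrable_cst.
rewrite -[LHS]fineK.
  congr EFin.
  rewrite -[LHS]/(\int[P]_w (cst (Num.max 0 (s + t - 1)) w +
    (Num.min s t - Num.max 0 (s + t - 1)) * \1_S w)).
  rewrite RintegralD// RintegralZl//; last exact: integrable_indic.
  rewrite Rintegral_indic// Rintegral_cst// -/p.
  by rewrite [X in fine X]probability_setT /=; ring.
exact: (integrable_fin_num _ (integrableD measurableT intc intS)).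
Qed.

Let U : d.-tuple {RV PQ >-> R} := [tuple sign_mfun i | i < d].

Lemma sign_copula_exists : exists2 C : d.-tuple R -> R, is_copula C &
  forall i j, i != j -> forall s t, 0 <= s <= 1 -> 0 <= t <= 1 ->
  margin2 C i j [tuple s; t] =
  (let p := fine (P (agree (B i) (B j))) in
   p * Num.min s t + (1 - p) * Num.max 0 (s + t - 1)).
Proof.
pose C (u : d.-tuple R) := fine (PQ [set w | forall i, tnth U i w <= tnth u i]).
have unifU i : std_uniform (tnth U i).
  move=> r r01; rewrite tnth_mktuple.
  (* For equal indices [agree] is the whole space, so p = 1 and the joint law reduces to min r r =
     r. *)
  have := sign_rv_joint i i r01 r01; rewrite setIid /= => UE.
  rewrite [LHS]UE agree_refl [X in fine X]probability_setT /= minxx.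
  by congr EFin; ring.
have UC : has_df U C.
  move=> u u01; rewrite /C fineK// fin_num_measure//.
  rewrite (_ : mkset _ = \bigcap_(i in [set: 'I_d])
    (tnth U i @^-1` `]-oo, tnth u i])).
    by apply: fin_bigcap_measurable => // i _; exact: measurable_funPTI.
  apply/seteqP; split => w /= uw i; first by move=> _; rewrite /= in_itv/=.
  by have := uw i Logic.I; rewrite /= in_itv.
exists C; first by exists _, _, PQ, U.
move=> i j ij s t s01 t01.
apply: EFin_inj; rewrite -sign_rv_joint//.
have := has_df2E (margin2P unifU UC ij) s01 t01.
by rewrite !tnth_mktuple => <-.
Qed.

End sign_copula.

(** * Covariances of symmetric Bernoulli variables *)

Section bernoulli.
Context (R : realType) dsp (Om : measurableType dsp) (P : probability Om R).
Implicit Types X Y : {RV P >-> R}.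

Definition sym_bernoulli X := P (X @^-1` [set 0]) = (2^-1)%:E /\
                              P (X @^-1` [set 1]) = (2^-1)%:E.

(** The values 0 and 1 have total probability 1, so all other values of [X] are taken on a null
    set. *)
Lemma sym_bernoulli_ae X : sym_bernoulli X ->
  \forall w \ae P, X w = \1_(X @^-1` [set 1]) w.
Proof.
move=> [X0 X1].
have m0 : measurable (X @^-1` [set 0]) by exact: measurable_funPTI.
have m1 : measurable (X @^-1` [set 1]) by exact: measurable_funPTI.
have m01 := measurableU _ _ m0 m1.
exists (~` (X @^-1` [set 0] `|` X @^-1` [set 1])); split.
- exact: measurableC.
- rewrite [LHS](probability_setC P m01) [X in (1 - X)%E](measureU P)//.
    rewrite [X in (_ - (X + _))%E]X0 [X in (_ - (_ + X))%E]X1.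
    rewrite -[X in (_ - X)%E]EFinD (_ : 2^-1 + 2^-1 = 1 :> R) ?subee//; lra.
  by apply/seteqP; split => // w [/= -> /eqP]; rewrite eq_sym oner_eq0.
- move=> w /= nXw [/= Xw|/= Xw]; apply: nXw; rewrite Xw indicE.
    by rewrite memNset//= Xw => /eqP; rewrite eq_sym oner_eq0.
  by rewrite mem_set.
Qed.

Lemma sym_bernoulli_expectation X : sym_bernoulli X -> fine 'E_P[X] = 2^-1.
Proof.
move=> symX; rewrite unlock.
rewrite (ae_eq_integral (fun w => (\1_(X @^-1` [set 1]) w)%:E))//.
- by rewrite integral_indic// setIT [X in fine X]symX.2.
- exact/measurable_EFinP.
- exact/measurable_EFinP/measurable_indic.
- by apply: filterS (sym_bernoulli_ae symX) => w -> _.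
Qed.

(* [(\1_A - 1/2) * (\1_A' - 1/2)] is [1/4] where [A] and [A'] agree and [- 1/4]
   elsewhere. *)
Lemma sym_bernoulli_covariance X Y : sym_bernoulli X -> sym_bernoulli Y ->
  fine (covariance P X Y) =
  2^-1 * fine (P (agree (X @^-1` [set 1]) (Y @^-1` [set 1]))) - 4^-1.
Proof.
move=> symX symY; rewrite covariance.unlock.
rewrite (sym_bernoulli_expectation symX) (sym_bernoulli_expectation symY).
rewrite unlock.
set S := agree _ _.
have mS : measurable S by exact: measurable_agree.
rewrite (ae_eq_integral (fun w => (2^-1 * \1_S w - 4^-1)%:E))//; last first.
- apply: filterS2 (sym_bernoulli_ae symX) (sym_bernoulli_ae symY) => w Xw Yw _.
  congr EFin; rewrite -[LHS]/((X w - 2^-1) * (Y w - 2^-1)).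
  rewrite Xw Yw !indicE /S agreeE.
  by case: (w \in _); case: (w \in _) => /=; lra.
- apply/measurable_EFinP/measurable_funB => //.
  by apply: measurable_funM => //; exact: measurable_indic.
- by apply/measurable_EFinP/measurable_funM; exact: measurable_funB.
rewrite -[LHS]/(\int[P]_w (2^-1 * \1_S w - cst 4^-1 w)).
rewrite RintegralB//.
- rewrite RintegralZl//; last exact: integrable_indic.
  rewrite Rintegral_indic// Rintegral_cst//.
  by rewrite [X in 4^-1 * fine X]probability_setT mulr1.
- by apply: integrable_EFinZl => //; exact: integrable_indic.
- exact: finite_measure_integrable_cst.
Qed.

(** A variance is the covariance of a variable with itself, where [agree] is everything: it equals
    1/2 - 1/4 = 1/4. Both standard deviations are thus 1/2, and the covariance gets multiplied by
    4. *)
Lemma sym_bernoulli_pearson X Y : sym_bernoulli X -> sym_bernoulli Y ->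
  pearson X Y =
  2 * fine (P (agree (X @^-1` [set 1]) (Y @^-1` [set 1]))) - 1.
Proof.
move=> symX symY.
have sqrt_var Z : sym_bernoulli Z -> Num.sqrt (fine 'V_P[Z]) = 2^-1.
  move=> symZ; rewrite /variance sym_bernoulli_covariance// agree_refl.
  rewrite [X in fine X]probability_setT /=.
  rewrite (_ : _ - _ = 2^-1 ^+ 2); last by field.
  by rewrite sqrtr_sqr ger0_norm.
rewrite /pearson !sqrt_var// sym_bernoulli_covariance//.
by field.
Qed.

End bernoulli.

(** * Lower inclusion: realizing Bernoulli correlations *)

Lemma cut_polytope_subset_compatible (R : realType) (d : nat)
    (gamma : (2.-tuple R -> R) -> R) :
  generalized_gini gamma -> cut_polytope R d `<=` compatible d gamma.
Proof.
move=> [mocg [mu [admmu _ gammaE]]] _ [dsp [Om [P [X [symX ->]]]]].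
pose B i := tnth X i @^-1` [set 1].
have mB i : measurable (B i) by exact: measurable_funPTI.
have [C copC CE] := sign_copula_exists P mB.
exists C => //; apply/matrixP => i j; rewrite !mxE sym_bernoulli_pearson//.
case: (eqVneq i j) => [->|ij].
  rewrite agree_refl [X in fine X]probability_setT (concordance_norm mocg) /=.
  lra.
rewrite gammaE; last exact: is_copula_margin2.
rewrite (Rintegral_excess_mixture admmu
  (p := fine (P (agree (B i) (B j)))) (C := margin2 C i j)).
  by rewrite mulfK// gt_eqF// excess_copM_gt0.
move=> x /open_squareP[x0 y0].
(* With the reflected term equal to Pi - W, the goal is that the margin is p M + (1 - p) W. *)
rewrite excess_copM_sigma2 /excess CE// /copM /copPi /tnth /=; ring.
Qed.

Theorem proposition5 (R : realType) (d : nat)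
    (gamma : (2.-tuple R -> R) -> R) (gini_gamma : generalized_gini gamma) :
  cut_polytope R d `<=` compatible d gamma /\
  compatible d gamma `<=` elliptope R d.
Proof.
split.
  exact: cut_polytope_subset_compatible.
exact: compatible_subset_elliptope.
Qed.
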